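(* Let $X$ be an infinite Hausdorff space such that $\mathscr{F}(X)$ has at least one continuous selection. Then $$X_\Omega=\{p\in X_\Theta : p \text{ is either isolated or a cut point of } X\}.$$
   Context: All spaces are infinite Hausdorff topological spaces. $\mathscr{F}(X)$ is the set of all nonempty closed subsets of $X$, endowed with the Vietoris topology $\tau_V$, which is generated by the sets $\langle\mathscr{V}\rangle=\{S\in\mathscr{F}(X): S\subset\bigcup\mathscr{V}$ and $S\cap V\neq\varnothing$ for every $V\in\mathscr{V}\}$, where $\mathscr{V}$ runs over the finite families of open subsets of $X$. A selection for $\mathscr{F}(X)$ is a map $f:\mathscr{F}(X)\to X$ with $f(S)\in S$ for every $S\in\mathscr{F}(X)$; it is continuous if it is continuous with respect to $\tau_V$. $X_\Theta=\{f(X): f \text{ is a continuous selection for } \mathscr{F}(X)\}$. A point $p\in X$ is countably-approachable if it is either isolated or there is an open set $U\subset X\setminus\{p\}$ with $\overline{U}=U\cup\{p\}$ such that $p$ has a countable base of clopen sets in the subspace $\overline{U}$. $X_\Omega$ is the set of all countably-approachable points of $X$. A point $p\in X$ is a cut point of $X$ if $X\setminus\{p\}=U\cup V$ and $\overline{U}\cap\overline{V}=\{p\}$ for some subsets $U,V\subset X$. *)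

(* Defs.v *)
From HB Require Import structures.
From mathcomp Require Import all_boot all_order all_algebra.
From mathcomp Require Import all_classical topology.

Set Implicit Arguments.
Unset Strict Implicit.
Unset Printing Implicit Defensive.

Local Open Scope classical_set_scope.

Record hyperspace (X : topologicalType) : Type := Hyperspace {
  hyperset :> set X ;
  hyperset_closed : closed hyperset ;
  hyperset_nonempty : hyperset !=set0
}.

HB.instance Definition _ (X : topologicalType) := gen_eqMixin (hyperspace X).
HB.instance Definition _ (X : topologicalType) :=
  gen_choiceMixin (hyperspace X).

Definition finite_open_families (X : topologicalType) : set (set (set X)) :=
  [set V | finite_set V /\ V `<=` open].

Definition vietoris_set (X : topologicalType) (V : set (set X)) :
    set (hyperspace X) :=
  [set S | hyperset S `<=` \bigcup_(W in V) W /\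
           forall W, V W -> hyperset S `&` W !=set0].

(* The Vietoris topology. The sets [vietoris_set V] already form a base, so
   generating from them as a subbase adds no open sets. *)
HB.instance Definition _ (X : topologicalType) :=
  @isSubBaseTopological.Build (hyperspace X) (set (set X))
    (@finite_open_families X) (@vietoris_set X).

Definition continuous_selection (X : topologicalType)
    (f : hyperspace X -> X) : Prop :=
  (forall S : hyperspace X, hyperset S (f S)) /\ continuous f.

(* The subset X_Theta; the witness S is X itself as a point of the
   hyperspace, and it exists as soon as X is nonempty. *)
Definition selection_points (X : topologicalType) : set X :=
  [set p | exists2 f : hyperspace X -> X, continuous_selection f &
           exists2 S : hyperspace X, hyperset S = setT & f S = p].
Arguments selection_points : clear implicits.

Definition countable_clopen_base_at (Y : topologicalType) (q : Y) : Prop :=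
  exists B : set (set Y),
    [/\ countable B, B `<=` clopen, B `<=` nbhs q &
        forall A, nbhs q A -> exists2 b, B b & b `<=` A].

(* The type [set_type (closure U)] carries the genuine subspace topology,
   whereas [subspace (closure U)] would still have all of X as carrier. *)
Definition countably_approachable (X : topologicalType) (p : X) : Prop :=
  isolated setT p \/
  exists U : set X,
    [/\ open U, U `<=` ~` [set p], closure U = U `|` [set p] &
        exists2 q : set_type (closure U),
          set_val q = p & countable_clopen_base_at q].

(* X_Omega *)
Definition approachable_points (X : topologicalType) : set X :=
  [set p | countably_approachable p].
Arguments approachable_points : clear implicits.

Definition cut_point (X : topologicalType) (p : X) : Prop :=
  exists U V : set X,
    ~` [set p] = U `|` V /\ closure U `&` closure V = [set p].

(* Main.v *)
Require Import Defs.
From mathcomp Require Import all_boot all_order all_algebra finmap.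
From mathcomp Require Import all_classical topology.
Local Open Scope classical_set_scope.

Set Implicit Arguments.
Unset Strict Implicit.
Unset Printing Implicit Defensive.

(** A point [p] that is not isolated is countably approachable if and only if
there is a sequence of nonempty clopen sets that miss [p] and converge to [p]
([approachable_null_sequence], [null_sequence_approachable]); everything is
proved in terms of such sequences [W].

From a sequence to a selection: look at the first [W n] that a closed set
misses and select in the set just before it.  The whole space misses no [W n],
and its value is [p] ([null_sequence_selection_value]).  Splitting a disjoint
sequence into two shows that [p] is a cut point ([null_sequence_cut_point]).

From a selection [F] with [F setT = p] to a sequence: by continuity, the values
on all the closed sets that contain a suitable finite set are close to [p].
Clopen sets come from two sources.  First, the set [escape F S] of the points
selected as soon as they are added to [S] is open, and its closure adds at most
the point [F S].  Secondly, if [E] is clopen, a closed set [M] that is maximal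
with [F M] in [E] is clopen, since adding a point close to [M] does not move the
value out of [E] ([maximal_extension]).

If [p] is the value of all the large closed sets through [p], the cut at [p]
serves to produce clopen sets: a large closed set without [p], enlarged on one
side of [p] only, can be made maximal without its value crossing over to that
side.  Adding points alternately on both sides of [p] yields an increasing
sequence of clopen sets whose values are forced to converge to [p], and the
corresponding escape sets, suitably cut down, converge to [p]
([eventually_selected_null_sequence]).

Otherwise there are arbitrarily large closed sets through [p] with values other
than [p], and even with values outside of the quasi-component of [p]: this is
[quasi_component_stabilization], which rests on the fact that the points of a
quasi-component near [p] are cut points that separate [p] from one of finitely
many fixed points.
Such values can be enclosed in clopen sets, and the second source gives disjoint
clopen sets [E n `|` D n] such that removing all the [D n] with [k <= n] leaves
a closed set with value in [E k].  Removing only the later and later ones of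
these sets leaves closed sets that exhaust [X], so the escape sets taken inside
of the removed parts converge to [p]
([not_eventually_selected_null_sequence]). *)

(** * The Vietoris topology and selections of closed sets *)

Definition vbox (X : Type) (K : set X) (V : set (set X)) : set (set X) :=
  [set S | S `<=` K /\ forall W, V W -> S `&` W !=set0].

Definition vbox_around (X : topologicalType) (S : set X) (K : set X)
    (V : set (set X)) : Prop :=
  [/\ open K, finite_set V, V `<=` open & vbox K V S].

Lemma open_vietoris_set (X : topologicalType) (V : set (set X)) :
  @finite_open_families X V -> open (@vietoris_set X V).
Proof.
move=> FV; exists [set (@vietoris_set X V)]; last by rewrite bigcup_set1.
move=> _ ->; exists [fset V]%fset.
  by move=> W /fset1P ->; apply/mem_set.
by rewrite set_fset1 bigcap_set1.
Qed.

Lemma vietoris_sets_vbox (X : topologicalType) (S : set X)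
    (s : seq (set (set X))) :
  (forall V, V \in s -> @finite_open_families X V) ->
  (forall V, V \in s -> S `<=` \bigcup_(W in V) W /\
     forall W, V W -> S `&` W !=set0) ->
  exists K V, vbox_around S K V /\
    forall T : hyperspace X, vbox K V T ->
      forall V', V' \in s -> vietoris_set V' T.
Proof.
elim: s => [_ _|U s IH sF sS].
  exists setT, set0; split => //; split => //.
  exact: openT.
have [|V sV|K [V [[oK fV Vo [SK SV]] VS]]] := IH.
- by move=> V sV; apply: sF; rewrite inE sV orbT.
- by apply: sS; rewrite inE sV orbT.
have [fU Uo] := sF _ (mem_head _ _).
have [SU SUm] := sS _ (mem_head _ _).
exists (K `&` \bigcup_(W in U) W), (V `|` U); split.
  split.
  - by apply: openI => //; apply: bigcup_open => W /Uo.
  - by rewrite finite_setU.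
  - by move=> W [/Vo|/Uo].
  - split=> [x Sx|W [/SV|/SUm]//]; split; [exact: SK|exact: SU].
move=> T [TK TV] V'; rewrite inE => /orP[/eqP ->|sV'].
  by split=> [x /TK[]|W UW] //; apply: TV; right.
apply: VS sV'; split=> [x /TK[]//|W VW]; apply: TV; by left.
Qed.

(** The members of a family defining a basic open set play two roles: their
union bounds the closed sets from above, and each of them must be met.  The
boxes [vbox K V] separate the two roles, which makes finite intersections of
basic open sets, and restrictions to clopen sets, boxes again. *)
Lemma nbhs_hyperspaceP (X : topologicalType) (S : hyperspace X)
    (A : set (hyperspace X)) :
  nbhs S A <-> exists K V, vbox_around S K V /\
    forall T : hyperspace X, vbox K V T -> A T.
Proof.
rewrite nbhsE; split=> [[B [[D Dfin <-] [C DC CS]] BA]|].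
  have [D' D'F /= E] := Dfin _ DC.
  have [|V|K [V [VS TV]]] := @vietoris_sets_vbox X S (enum_fset D').
  - by move=> V /D'F; rewrite inE.
  - by move=> VD; have : @vietoris_set X V S by rewrite -E in CS; exact: CS.
  exists K, V; split=> // T /TV TD; apply: BA.
  by eexists; first exact: DC; rewrite /= -E => V' /TD.
move=> [K [V [[oK fV Vo [SK SV]] VA]]].
pose V' := [set K] `|` [set W `&` K | W in V].
exists (@vietoris_set X V'); first split.
- apply: open_vietoris_set; split.
    by rewrite finite_setU; split => //; exact: finite_image.
  by move=> W [->|[W' /Vo oW' <-]] //; exact: openI.
- split=> [x Sx|W [->|[W' /SV [x [Sx W'x]] <-]]].
  + by exists K; [left|exact: SK].
  + have [x Sx] := hyperset_nonempty S; exists x; split => //; exact: SK.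
  + by exists x; split => //; split => //; exact: SK.
move=> T [TK TV]; apply: VA; split=> [x /TK[W [->//|[W' _ <-] []//]]|W VW].
by have [|x [Tx [Wx _]]] := TV (W `&` K); [right; exists W|exists x].
Qed.

(** A selection presented as a total function on sets, whose values matter
only on nonempty closed sets, so that unions, closures and restrictions can be
formed without carrying closedness proofs. *)
Definition set_selection (X : topologicalType) (F : set X -> X) : Prop :=
  (forall S, closed S -> S !=set0 -> S (F S)) /\
  forall S O, closed S -> S !=set0 -> open O -> O (F S) ->
    exists K V, vbox_around S K V /\
      forall T, closed T -> T !=set0 -> vbox K V T -> O (F T).

Lemma hyperset_inj (X : topologicalType) : injective (@hyperset X).
Proof.
move=> [S cS nS] [T cT nT] /= ST; case: T / ST cT nT => cT nT.
by congr Hyperspace; exact: Prop_irrelevance.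
Qed.

Lemma selection_pointsP (X : topologicalType) (p : X) :
  selection_points X p <-> exists2 F, set_selection F & F [set: X] = p.
Proof.
split=> [[f [fS fc] [S ST fSp]]|[F [FS Fc] FT]].
  pose F (T : set X) := if pselect (closed T /\ T !=set0) is left H
    then f (Hyperspace H.1 H.2) else p.
  have FE (T : hyperspace X) : F T = f T.
    rewrite /F; case: pselect => [H|[]]; last first.
      by split; [exact: hyperset_closed|exact: hyperset_nonempty].
    by congr f; apply: hyperset_inj.
  exists F; last by rewrite -ST FE.
  split=> [T cT nT|T O cT nT oO].
    by have := fS (Hyperspace cT nT); rewrite -FE.
  rewrite -[T]/(hyperset (Hyperspace cT nT)) FE => OT.
  have /nbhs_hyperspaceP[K [V [KV KVO]]] := fc (Hyperspace cT nT) O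
    (open_nbhs_nbhs (conj oO OT)).
  exists K, V; split=> // T' cT' nT' T'KV.
  by have := KVO (Hyperspace cT' nT') T'KV; rewrite /= -FE.
have [T0 n0] : closed [set: X] /\ [set: X] !=set0.
  by split; [exact: closedT|exists p].
exists (fun S : hyperspace X => F S); last by exists (Hyperspace T0 n0).
split=> [S|S O]; first by have := FS _ (@hyperset_closed _ S) (@hyperset_nonempty _ S).
rewrite nbhsE => -[O' [oO' O'S] O'O]; apply/nbhs_hyperspaceP.
have [K [V [KV KVO]]] := Fc _ O' (@hyperset_closed _ S) (@hyperset_nonempty _ S) oO' O'S.
exists K, V; split=> // T /KVO TO; apply: O'O; apply: TO.
- exact: hyperset_closed.
- exact: hyperset_nonempty.
Qed.

(** * Countable approachability and null sequences of clopen sets *)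

Lemma hausdorff_open_sep (X : topologicalType) (x y : X) :
  hausdorff_space X -> x <> y ->
  exists A B, [/\ open A, open B, A x, B y & A `&` B = set0].
Proof.
rewrite open_hausdorff => sep /eqP /sep[[A B] /= [xA yB] [oA oB /eqP AB0]].
by exists A, B; split => //; exact: set_mem.
Qed.

Lemma hausdorff_closed1 (X : topologicalType) (x : X) :
  hausdorff_space X -> closed [set x].
Proof.
by move=> /hausdorff_accessible /accessible_closed_set1; exact.
Qed.

(** For a point that is not isolated this is a form of countable
approachability intrinsic to [X]: the differences of a decreasing countable
clopen base of [p] in [U `|` [set p]] are clopen in the whole space. *)
Definition clopen_null_sequence (X : topologicalType) (p : X)
    (W : nat -> set X) : Prop :=
  (forall n, [/\ clopen (W n), W n !=set0 & ~ W n p]) /\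
  forall O, open O -> O p -> exists k, forall n, (k <= n)%N -> W n `<=` O.

Lemma clopen_bigcup_ltn (X : topologicalType) (W : nat -> set X) n :
  (forall i, (i < n)%N -> clopen (W i)) -> clopen (\bigcup_(i in `I_n) W i).
Proof.
move=> cW; split; first by apply: bigcup_open => i /cW[].
by apply: closed_bigcup => [|i /cW[]]; first exact: finite_II.
Qed.

Lemma closure_bigcup_null (X : topologicalType) (p : X) (W : nat -> set X) :
  hausdorff_space X -> clopen_null_sequence p W ->
  closure (\bigcup_n W n) = \bigcup_n W n `|` [set p].
Proof.
move=> hX [Wc Wp]; apply/seteqP; split=> x.
  move=> clx; apply: contrapT => /not_orP[nWx nxp].
  have [A [B [oA oB Ax Bp AB0]]] := hausdorff_open_sep hX nxp.
  have [k kB] := Wp _ oB Bp.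
  have [_ cWk] : clopen (\bigcup_(i in `I_k) W i).
    by apply: clopen_bigcup_ltn => i _; have [] := Wc i.
  have [|y [[n _ Wny] [Ay nWy]]] := clx (A `&` ~` \bigcup_(i in `I_k) W i).
    apply: open_nbhs_nbhs; split; first by apply: openI => //; exact: closed_openC.
    by split=> // -[i _ Wix]; apply: nWx; exists i.
  have [nk|kn] := ltnP n k; first by apply: nWy; exists n.
  suff : set0 y by [].
  by rewrite -AB0; split=> //; exact: kB Wny.
case=> [|->]; first exact: subset_closure.
move=> O; rewrite nbhsE => -[O' [oO' O'p] O'O].
have [k kO'] := Wp _ oO' O'p; have [_ [y Wky] _] := Wc k.
by exists y; split; [exists k|apply/O'O/kO'/Wky].
Qed.

Lemma null_sequence_approachable (X : topologicalType) (p : X)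
    (W : nat -> set X) :
  hausdorff_space X -> clopen_null_sequence p W -> countably_approachable p.
Proof.
move=> hX Wnull; right; have [Wc Wp] := Wnull.
have clU := closure_bigcup_null hX Wnull.
exists (\bigcup_n W n); split => //.
- by apply: bigcup_open => n _; have [[]] := Wc n.
- by move=> x [n _ Wnx] xp; have [_ _] := Wc n; rewrite -xp.
set Y := closure _; have Yp : Y p by rewrite /Y clU; right.
exists (SigSub (mem_set Yp)) => //.
pose b (n : nat) : set (set_type Y) := set_val @^-1` (~` \bigcup_(i in `I_n) W i).
have sv_cont : continuous (set_val : set_type Y -> X) by exact: initial_continuous.
have Wcn n : clopen (\bigcup_(i in `I_n) W i).
  by apply: clopen_bigcup_ltn => i _; have [] := Wc i.
have bc n : clopen (b n) by apply: preimage_clopen => //; apply: clopenC.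
exists (range b); split.
- by apply: card_le_trans (card_image_le _ _) _; exact: countableP.
- by move=> _ [n _ <-].
- move=> _ [n _ <-]; apply: open_nbhs_nbhs; split; first by have [] := bc n.
  by move=> [i _ Wip]; have [_ _] := Wc i.
move=> A; rewrite nbhsE => -[A' [[O oO <-] /= Op] OA].
have [k kO] := Wp _ oO Op.
exists (b k); first by exists k.
move=> y nWy; apply: OA => /=.
have YE : Y `<=` \bigcup_n W n `|` [set p] by rewrite /Y clU.
have [[n _ Wny]|yp] := YE _ (set_valP y); last by have -> : set_val y = p by [].
have [nk|kn] := ltnP n k; last exact: kO Wny.
by case: nWy; exists n.
Qed.

(** A basic clopen set of [closure U] minus a smaller one misses [p], so it is
contained in the open set [U]; thus it is open in [X] as well as closed. *)
Lemma approachable_null_sequence (X : topologicalType) (p : X) (U : set X) :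
  hausdorff_space X -> open U -> U `<=` ~` [set p] ->
  closure U = U `|` [set p] ->
  (exists2 q : set_type (closure U),
     set_val q = p & countable_clopen_base_at q) ->
  exists W, clopen_null_sequence p W.
Proof.
move=> hX oU Up clU [q qp [B [cB Bc Bq Bbase]]].
have /pcard_surjP[e eB] := cB.
pose inB n (x : X) := exists2 y, set_val y = x & e n y.
have small n : exists C : set (set_type (closure U)),
    [/\ clopen C, C q & forall i, (i < n)%N -> B (e i) -> C `<=` e i].
  elim: n => [|n [C [cC Cq Ce]]]; first by exists setT; split=> //; exact: clopenT.
  have [Ben|nBen] := pselect (B (e n)); last first.
    by exists C; split=> // i; rewrite ltnS leq_eqVlt => /orP[/eqP ->|/Ce].
  exists (C `&` e n); split.
  - by apply: clopenI => //; exact: Bc.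
  - by split=> //; apply: nbhs_singleton; exact: Bq.
  move=> i; rewrite ltnS leq_eqVlt => /orP[/eqP -> _|/Ce iC /iC]; first exact: subIsetr.
  by move=> Cei x [/Cei].
have /choice[W WP] n : exists W : set X, [/\ clopen W, W !=set0, ~ W p &
    forall i, (i < n)%N -> B (e i) -> W `<=` inB i].
  have [C [[oC cC] Cq Ce]] := small n.
  have [O oO OC] := oC.
  have [x [Ux Ox]] : (U `&` O) !=set0.
    have : closure U p by rewrite clU; right.
    apply; apply: open_nbhs_nbhs; split=> //.
    by move: Cq; rewrite -OC /= qp.
  have xp : p <> x by move=> px; exact: (Up _ Ux).
  have [A [A' [oA oA' Ap A'x AA'0]]] := hausdorff_open_sep hX xp.
  have [|b Bb bA] := Bbase (set_val @^-1` A).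
    apply: open_nbhs_nbhs; split; first by exists A.
    by rewrite /= qp.
  have [[O' oO' O'b] cb] := Bc _ Bb.
  have bq : b q by apply: nbhs_singleton; exact: Bq.
  exists (set_val @` (C `\` b)).
  have imE : set_val @` (C `\` b) = U `&` O `&` ~` (closure U `&` O').
    apply/seteqP; split=> [_ [y [Cy nby] <-]|z [[Uz Oz] nO'z]].
      have clUE : closure U `<=` U `|` [set p] by rewrite clU.
      have [Uy|yp] := clUE _ (set_valP y); last first.
        case: nby; suff -> : y = q by [].
        by apply: val_inj; rewrite /= yp.
      split; first by split=> //; move: Cy; rewrite -OC.
      by move=> [_ O'y]; apply: nby; rewrite -O'b.
    have clz : closure U z by apply: subset_closure.
    exists (SigSub (mem_set clz)) => //; split; first by rewrite -OC.
    by move=> bz; apply: nO'z; split => //; rewrite -O'b in bz.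
  have valc (D : set (set_type (closure U))) : closed D -> closed (set_val @` D).
    move=> cD; have [Q oQ QD] : open (~` D) by exact: closed_openC.
    suff -> : set_val @` D = closure U `&` ~` Q.
      by apply: closedI; [exact: closed_closure|exact: open_closedC].
    apply/seteqP; split=> [_ [y Dy <-]|z [clz nQz]].
      split; first exact: set_valP.
      by move=> Qy; have : (~` D) y by rewrite -QD.
    exists (SigSub (mem_set clz)) => //; apply: contrapT => nD.
    by apply: nQz; have : (~` D) (SigSub (mem_set clz)) by []; rewrite -QD.
  split.
  - split; last by apply: valc; apply: closedI => //; exact: open_closedC (Bc _ Bb).1.
    have -> : set_val @` (C `\` b) = U `&` O `&` ~` (set_val @` b).
      rewrite imE; congr setI; congr setC.
      apply/seteqP; split=> [z [clz O'z]|_ [y by_ <-]].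
        by exists (SigSub (mem_set clz)) => //; rewrite -O'b.
      by split; [exact: set_valP|rewrite -O'b in by_].
    apply: openI; first exact: openI.
    by apply: closed_openC; exact: valc.
  - have clx : closure U x by exact: subset_closure.
    exists x; exists (SigSub (mem_set clx)) => //; split; first by rewrite -OC.
    move=> /bA /= Ax; suff : set0 x by [].
    by rewrite -AA'0.
  - by rewrite imE => -[[/Up np _] _]; exact: np.
  by move=> i iln Bei _ [y [Cy _] <-]; exists y => //; exact: Ce iln Bei _ Cy.
exists W; split=> [n|O oO Op]; first by have [] := WP n.
have [|b /[dup] Bb /eB[k _ ekb] bO] := Bbase (set_val @^-1` O).
  by apply: open_nbhs_nbhs; split; [exists O|rewrite /= qp].
exists k.+1 => n kn; have [_ _ _ /(_ _ kn)] := WP n.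
move=> /(_ _) WB x; rewrite -ekb in Bb bO.
by case/(WB Bb) => y <- /bO.
Qed.

(** * Approachable points are selection values, and cut points *)

(** Choose [p] whenever possible: as [p] is isolated, the closed sets through
[p] form a clopen part of the hyperspace. *)
Lemma isolated_selection_value (X : topologicalType) (p : X) (F : set X -> X) :
  open [set p] -> closed [set p] -> set_selection F ->
  exists2 F', set_selection F' & F' [set: X] = p.
Proof.
move=> op cp [FS Fc]; pose F' S := if pselect (S p) then p else F S.
exists F'; last by rewrite /F'; case: pselect => // -[].
split=> [S cS nS|S O cS nS oO]; rewrite /F'; case: pselect => // Sp.
- exact: FS.
- move=> Op; exists setT, [set [set p]]; split.
    split; [exact: openT|exact: finite_set1|by move=> _ ->|split=> // _ ->].
    by exists p.
  move=> T cT nT [_ /(_ _ erefl)[x [Tx xp]]].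
  by case: pselect => // -[]; rewrite -xp.
move=> /= OFS; have [K [V [[oK fV Vo [SK SV]] VO]]] := Fc S O cS nS oO OFS.
exists (K `&` ~` [set p]), V; split.
  split=> //; first by apply: openI => //; exact: closed_openC.
  split=> // x Sx; split; [exact: SK|move=> xp].
  by apply: Sp; rewrite -xp.
move=> T cT nT [TK TV]; case: pselect => [/TK[_ []]//|nTp].
by apply: VO => //; split=> // x /TK[].
Qed.

Definition first_missed (X : Type) (W : nat -> set X) (S : set X) : set nat :=
  [set n | (forall i, (i < n)%N -> S `&` W i !=set0) /\ S `&` W n = set0].

Lemma first_missed_uniq (X : Type) (W : nat -> set X) S m n :
  first_missed W S m -> first_missed W S n -> m = n.
Proof.
move=> [mS Wm] [nS Wn]; apply/eqP; rewrite eqn_leq leqNgt [in X in _ && X]leqNgt.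
apply/andP; split; apply/negP.
  by move=> /mS; rewrite Wn => -[].
by move=> /nS; rewrite Wm => -[].
Qed.

Lemma first_missed_ex (X : Type) (W : nat -> set X) S n :
  S `&` W n = set0 -> exists m, first_missed W S m.
Proof.
move=> SWn; have ex : exists n, `[< S `&` W n = set0 >] by exists n; apply/asboolP.
exists (ex_minn ex); case: ex_minnP => m /asboolP SWm mmin; split=> // i im.
apply: contrapT => /set0P/negP; rewrite negbK => /eqP SWi.
by have := mmin i; rewrite leqNgt im => /(_ (asboolT SWi)).
Qed.

(** Select in the last of the clopen sets that a closed set meets before it
first misses one of them; a closed set that misses none of them contains [p],
and gets [p].  The whole space misses none. *)
Definition level_selection (X : Type) (p : X) (W : nat -> set X)
    (F : set X -> X) (S : set X) : X :=
  if pselect (exists n, first_missed W S n) then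
    if xget 0%N (first_missed W S) is n.+1 then F (S `&` W n) else F S
  else p.

Lemma level_selectionE (X : Type) (p : X) (W : nat -> set X) F S n :
  first_missed W S n ->
  level_selection p W F S = if n is m.+1 then F (S `&` W m) else F S.
Proof.
move=> Sn; rewrite /level_selection; case: pselect => /= [_|[]]; last by exists n.
case: xgetP => [m _ Sm|/(_ n)//].
by rewrite (first_missed_uniq Sm Sn).
Qed.

(** The first missed index is locally constant, since the [W n] are clopen; a
set that misses none is approximated by sets that meet [W 0], ..., [W k], whose
values lie in some [W n] with [k <= n], that is, close to [p]. *)
Lemma null_sequence_selection_value (X : topologicalType) (p : X)
    (W : nat -> set X) (F : set X -> X) :
  clopen_null_sequence p W -> set_selection F ->
  exists2 F', set_selection F' & F' [set: X] = p.
Proof.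
move=> [Wc Wp] [FS Fc]; exists (level_selection p W F); last first.
  rewrite /level_selection; case: pselect => //= -[n [_]].
  by have [_ [x Wx] _] := Wc n; rewrite setTI => W0; rewrite W0 in Wx.
have cSW S n : closed S -> closed (S `&` W n).
  by move=> cS; apply: closedI => //; have [[]] := Wc n.
split=> [S cS nS|S O cS nS oO].
  rewrite /level_selection; case: pselect => /= [[n Sn]|nex].
    have := level_selectionE p F Sn.
    rewrite /level_selection; case: pselect => /= [_ ->|[]]; last by exists n.
    case: n Sn => [_|n [nS' _]]; first exact: FS.
    by have [] := FS _ (cSW S n cS) (nS' n (ltnSn n)).
  apply: cS => O; rewrite nbhsE => -[O' [oO' O'p] O'O].
  have [k kO'] := Wp _ oO' O'p.
  suff [x [Sx Wx]] : S `&` W k !=set0 by exists x; split=> //; exact/O'O/(kO' k).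
  apply/set0P/negP => /eqP SWk.
  by apply: nex; exact: first_missed_ex SWk.
have [[n Sn]|nex] := pselect (exists n, first_missed W S n).
  have missK T : T `<=` ~` W n -> (forall i, (i < n)%N -> T `&` W i !=set0) ->
      first_missed W T n.
    by move=> TW TWi; split=> //; apply/disjoints_subset.
  have fin_meet m : finite_set (W @` `I_m) by exact/finite_image/finite_II.
  have open_meet m : W @` `I_m `<=` open by move=> _ [i _ <-]; have [[]] := Wc i.
  rewrite (level_selectionE p F Sn) => OFS.
  have [Smeet Smiss] := Sn.
  case: n => [|n] in Sn Smeet Smiss missK OFS *.
    have [K [V [[oK fV Vo [SK SV]] VO]]] := Fc S O cS nS oO OFS.
    exists (K `&` ~` W 0%N), V; split.
      split=> //; first by apply: openI => //; apply: closed_openC; have [[]] := Wc 0%N.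
      by split=> // x Sx; split; [exact: SK|move/disjoints_subset: Smiss; exact].
    move=> T cT nT [TK TV].
    rewrite (@level_selectionE _ p W F T 0) //; last by apply: missK => // x /TK[].
    by apply: VO => //; split=> // x /TK[].
  have nSW : S `&` W n !=set0 by exact: Smeet.
  have [K [V [[oK fV Vo [SK SV]] VO]]] := Fc _ O (cSW S n cS) nSW oO OFS.
  exists ((K `|` ~` W n) `&` ~` W n.+1),
    ([set A `&` W n | A in V] `|` W @` `I_n.+1); split.
    split=> //.
    - apply: openI; last by apply: closed_openC; have [[]] := Wc n.+1.
      by apply: openU => //; apply: closed_openC; have [[]] := Wc n.
    - by rewrite finite_setU; split=> //; exact: finite_image.
    - move=> A [[B VB <-]|/open_meet//].
      by apply: openI; [exact: Vo|have [[]] := Wc n].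
    split=> [x Sx|A [[B VB <-]|[i i_n <-]]].
    - split; last by move/disjoints_subset: Smiss; exact.
      by have [Wx|nWx] := pselect (W n x); [left; apply: SK|right].
    - by have [x [[Sx Wx] Bx]] := SV _ VB; exists x.
    - exact: Smeet.
  move=> T cT nT [TK TV].
  have Tn : first_missed W T n.+1.
    apply: missK => [x /TK[]//|i i_n]; apply: TV; right; by exists i.
  rewrite (level_selectionE p F Tn); apply: VO.
  - exact: cSW.
  - by apply: Tn.1.
  split=> [x [/TK[[//|nWx] _] Wx]//|A VA].
  have [|x [Tx [Ax Wx]]] := TV (A `&` W n); first by left; exists A.
  by exists x.
have -> : level_selection p W F S = p by rewrite /level_selection; case: pselect.
move=> Op; have [k kO] := Wp _ oO Op.
exists setT, (W @` `I_k.+1); split.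
  split; [exact: openT|exact/finite_image/finite_II| |].
    by move=> _ [i _ <-]; have [[]] := Wc i.
  split=> // _ [i _ <-]; apply/set0P/negP => /eqP SWi.
  by apply: nex; exact: first_missed_ex SWi.
move=> T cT nT [_ TV].
have [[n Tn]|nexT] := pselect (exists n, first_missed W T n); last first.
  by rewrite /level_selection; case: pselect.
rewrite (level_selectionE p F Tn).
have kn : (k < n)%N.
  rewrite ltnNge; apply/negP => nk.
  have [x Tx] := TV (W n) (ex_intro2 _ _ n (nk : `I_k.+1 n) erefl).
  by have [_ T0] := Tn; rewrite T0 in Tx.
case: n kn Tn => // n kn [Tmeet _].
have [_ Wn] := FS _ (cSW T n cT) (Tmeet n (ltnSn n)).
exact: kO Wn.
Qed.

(** A set [W n] misses a neighbourhood of [p], hence almost all the others. *)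
Lemma null_sequence_disjoint (X : topologicalType) (p : X) (W : nat -> set X) :
  clopen_null_sequence p W -> exists2 W', clopen_null_sequence p W' &
    forall m n, (m < n)%N -> W' m `&` W' n = set0.
Proof.
move=> [Wc Wp].
have /choice[next nextP] n : exists k, (n < k)%N /\
    forall j, (k <= j)%N -> W n `&` W j = set0.
  have [[oW cW] _ nWp] := Wc n.
  have [k kW] := Wp _ (closed_openC cW) nWp.
  exists (maxn n.+1 k); split=> [|j]; first exact: leq_maxl.
  rewrite geq_max => /andP[_ /kW jW].
  by rewrite setIC; apply/disjoints_subset.
pose idx n := iter n next 0%N.
have idx_lt m n : (m < n)%N -> (next (idx m) <= idx n)%N.
  elim: n => // n IH; rewrite ltnS leq_eqVlt => /orP[/eqP ->//|/IH mn].
  by apply: leq_trans mn _; apply: ltnW; have [] := nextP (idx n).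
have idx_ge n : (n <= idx n)%N.
  by elim: n => // n IH; apply: leq_ltn_trans IH _; have [] := nextP (idx n).
exists (W \o idx) => [|m n /idx_lt mn].
  split=> [n|O oO Op]; first exact: Wc.
  have [k kO] := Wp _ oO Op; exists k => n kn.
  by apply: kO; exact: leq_trans kn (idx_ge n).
by have [_] := nextP (idx m); exact.
Qed.

(** The sets of odd index in a disjoint sequence go to one side, everything
else to the other one, which [p] adheres to thanks to the sets of even index. *)
Lemma null_sequence_cut_point (X : topologicalType) (p : X) (W : nat -> set X) :
  hausdorff_space X -> clopen_null_sequence p W -> cut_point p.
Proof.
move=> hX /null_sequence_disjoint[{}W [Wc Wp] Wd].
have sub_null (h : nat -> nat) : (forall n, (n <= h n)%N) ->
    clopen_null_sequence p (W \o h).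
  move=> hn; split=> [n|O oO Op]; first exact: Wc.
  have [k kO] := Wp _ oO Op; exists k => n kn.
  by apply: kO; exact: leq_trans kn (hn n).
have odd_null : clopen_null_sequence p (W \o (fun n => n.*2.+1)).
  by apply: sub_null => n; rewrite -addnn -addnS leq_addr.
have even_null : clopen_null_sequence p (W \o (fun n => n.*2)).
  by apply: sub_null => n; rewrite -addnn leq_addr.
set Q := \bigcup_n W n.*2.+1.
have clQ : closure Q = Q `|` [set p] by exact: closure_bigcup_null hX odd_null.
have oQ : open Q by apply: bigcup_open => n _; have [[]] := Wc n.*2.+1.
have nQp : ~ Q p by move=> [n _]; have [] := Wc n.*2.+1.
exists Q, (~` Q `&` ~` [set p]); split.
  apply/seteqP; split=> [x xp|x [Qx xp|[]//]].
    by have [Qx|nQx] := pselect (Q x); [left|right].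
  by apply: nQp; rewrite -xp.
apply/seteqP; split=> [x [clx clx']|_ ->].
  move: clx; rewrite clQ => -[Qx|//].
  by have [y [[nQy _] Qy]] := clx' Q (open_nbhs_nbhs (conj oQ Qx)).
split; first by rewrite clQ; right.
have : closure (\bigcup_n W n.*2) p.
  by rewrite (closure_bigcup_null hX even_null); right.
apply: closureS => x [n _ Wnx]; split=> [[m _ Wmx]|xp].
  have [mn|nm] := ltnP m.*2.+1 n.*2.
    suff : set0 x by [].
    by rewrite -(Wd _ _ mn).
  have nm' : (n.*2 < m.*2.+1)%N.
    rewrite ltn_neqAle nm andbT; apply/eqP => nmE.
    by have := congr1 odd nmE; rewrite /= !odd_double.
  suff : set0 x by [].
  by rewrite -(Wd _ _ nm').
by have [_ _] := Wc n.*2; rewrite -xp.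
Qed.

(** * Continuity of a selection along finite changes and along chains *)

Lemma monotone_seq_cover (T : eqType) (H : nat -> set T) (s : seq T) :
  (forall m n, (m <= n)%N -> H m `<=` H n) ->
  [set` s] `<=` \bigcup_n H n ->
  exists k, forall n, (k <= n)%N -> [set` s] `<=` H n.
Proof.
move=> Hmono; elim: s => [_|x s IH sH]; first by exists 0%N.
have [|k kH] := IH; first by move=> y ys; apply: sH; rewrite /= inE ys orbT.
have [m _ Hmx] := sH x (mem_head _ _).
exists (maxn k m) => n; rewrite geq_max => /andP[kn mn] y.
rewrite /= inE => /orP[/eqP ->|ys]; [exact: Hmono Hmx|exact: kH].
Qed.

Lemma closed_setU_seq (X : topologicalType) (S : set X) (t : seq X) :
  hausdorff_space X -> closed S -> closed (S `|` [set` t]).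
Proof.
move=> hX cS; apply: closedU => //.
have -> : [set` t] = \bigcup_(x in [set` t]) [set x].
  by apply/seteqP; split=> [x xt|x [y yt ->]//]; exists x.
apply: closed_bigcup => [|x _]; first exact: finite_seq.
exact: hausdorff_closed1.
Qed.

(** A Vietoris neighbourhood of [S] constrains the closed subsets of [S] only by
finitely many open sets to be met, for which finitely many points of a dense
subset suffice. *)
Lemma selection_near_dense (X : topologicalType) (F : set X -> X)
    (D S O : set X) :
  set_selection F -> closed S -> S !=set0 -> D `<=` S -> S `<=` closure D ->
  open O -> O (F S) ->
  exists s : seq X, [set` s] `<=` D /\
    forall T, closed T -> [set` s] `<=` T -> T `<=` S -> O (F T).
Proof.
move=> [FS Fc] cS nS DS SD oO OFS.
have [K [V [[oK fV Vo [SK SV]] VO]]] := Fc S O cS nS oO OFS.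
have [x0 Sx0] := nS; have [d0 [Dd0 _]] := SD _ Sx0 setT filterT.
have /choice[pick pickP] W : exists x, V W -> D x /\ W x.
  have [VW|] := pselect (V W); last by exists d0.
  have [x [Sx Wx]] := SV _ VW.
  have [y [Dy Wy]] := SD _ Sx W (open_nbhs_nbhs (conj (Vo _ VW) Wx)).
  by exists y.
have /finite_seqP[s sE] : finite_set (pick @` V) by exact: finite_image.
(* adding [d0] makes sure that the sets above the list are nonempty *)
exists (d0 :: s); split.
  move=> x /=; rewrite inE => /orP[/eqP -> //|xs].
  by have : [set` s] x by []; rewrite -sE => -[W /pickP[Dx _] <-].
move=> T cT sT TS; apply: VO => //.
  by exists d0; apply: sT; rewrite /= mem_head.
split=> [x /TS/SK//|W VW]; exists (pick W); split; last by have [] := pickP _ VW.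
apply: sT; rewrite /= inE; apply/orP; right.
by have : [set` s] (pick W); first by rewrite -sE; exists W.
Qed.

Lemma selection_near (X : topologicalType) (F : set X -> X) (S O : set X) :
  set_selection F -> closed S -> S !=set0 -> open O -> O (F S) ->
  exists s : seq X, [set` s] `<=` S /\
    forall T, closed T -> [set` s] `<=` T -> T `<=` S -> O (F T).
Proof.
by move=> Fsel cS nS; apply: selection_near_dense => //; exact: subset_closure.
Qed.

Lemma selection_add_continuous (X : topologicalType) (F : set X -> X)
    (S : set X) :
  hausdorff_space X -> set_selection F -> closed S ->
  continuous (fun y => F (S `|` [set y])).
Proof.
move=> hX [FS Fc] cS x O.
rewrite nbhsE => -[O' [oO' O'F] O'O].
have cSx y : closed (S `|` [set y]).
  by apply: closedU => //; exact: hausdorff_closed1.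
have nSx y : S `|` [set y] !=set0 by exists y; right.
have [K [V [[oK fV Vo [SK SV]] VO]]] := Fc _ _ (cSx x) (nSx x) oO' O'F.
have /finite_fsetP[A VA] := fV.
have nN : nbhs x (K `&` \bigcap_(W in [set` A]) [set y | W x -> W y]).
  apply: filterI; first by apply: open_nbhs_nbhs; split=> //; apply: SK; right.
  apply: filter_bigI => W WA; have VW : V W by rewrite VA.
  have [Wx|nWx] := pselect (W x).
    have nW : nbhs x W by apply: open_nbhs_nbhs; split=> //; exact: Vo.
    by apply: filterS nW => y Wy _.
  by apply: filterS filterT => y _ /nWx.
apply: filterS nN => y [Ky Wy]; apply: O'O; apply: VO => //.
split=> [z [Sz|->]//|W VW]; first by apply: SK; left.
have [z [[Sz|zx] Wz]] := SV _ VW; first by exists z; split => //; left.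
exists y; split; first by right.
by apply: Wy; [rewrite VA in VW|rewrite -zx].
Qed.

Lemma closed_fixpoints (X : topologicalType) (g : X -> X) :
  hausdorff_space X -> continuous g -> closed [set y | g y = y].
Proof.
move=> hX gc; rewrite -openC openE => x /= gx.
have [A [B [oA oB Agx Bx AB0]]] := hausdorff_open_sep hX gx.
have nA : nbhs x (g @^-1` A) by apply: gc; exact: open_nbhs_nbhs.
have nB : nbhs x B by exact: open_nbhs_nbhs.
apply: filterS (filterI nA nB) => y [/= Agy By] gy; rewrite gy in Agy.
by have : set0 y by rewrite -AB0.
Qed.

(** The points that are selected as soon as they are added to [S]. *)
Definition escape (X : Type) (F : set X -> X) (S : set X) : set X :=
  [set y | ~ S (F (S `|` [set y]))].

Section EscapeTheory.
Variables (X : topologicalType) (F : set X -> X).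
Hypotheses (hX : hausdorff_space X) (Fsel : set_selection F).

Lemma escape_val S y : closed S -> escape F S y -> F (S `|` [set y]) = y.
Proof.
move=> cS Sy; have cSy : closed (S `|` [set y]).
  by apply: closedU => //; exact: hausdorff_closed1.
by have [|//] := Fsel.1 _ cSy (ex_intro _ y (or_intror erefl)).
Qed.

Lemma escape_notin S y : closed S -> escape F S y -> ~ S y.
Proof. by move=> cS Sy; have := Sy; rewrite /escape /= escape_val. Qed.

Lemma escapeP S y : ~ S y -> F (S `|` [set y]) = y -> escape F S y.
Proof. by rewrite /escape /= => + ->. Qed.

Lemma open_escape S : closed S -> open (escape F S).
Proof.
move=> cS.
have /continuousP := selection_add_continuous hX Fsel cS.
by move=> /(_ _ (closed_openC cS)).
Qed.

(** The value [F S] is the only possible limit of escaping points outside of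
the escaping points: such a limit [y] is selected from [S `|` [set y]], hence
escapes unless it lies in [S]. *)
Lemma closure_escape S : closed S ->
  closure (escape F S) `<=` escape F S `|` [set F S].
Proof.
move=> cS y cly.
have cfix := closed_fixpoints hX (selection_add_continuous hX Fsel cS).
have Fy : F (S `|` [set y]) = y.
  apply: cfix; apply: closureS cly => z; exact: escape_val.
have [Sy|nSy] := pselect (S y); last by left; exact: escapeP.
right; rewrite -{1}Fy; congr F; apply/seteqP; split=> z; last by left.
by case=> // ->.
Qed.

Lemma setU_seq_rem (S : set X) (t : seq X) b : b \in t ->
  S `|` [set` t] = S `|` [set` [seq x <- t | x != b]] `|` [set b].
Proof.
move=> bt; apply/seteqP; split=> x /=.
  case=> [|xt]; first by left; left.
  have [->|xb] := eqVneq x b; first by right.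
  by left; right; rewrite mem_filter xb.
by case=> [[|]|->]; [left|rewrite mem_filter => /andP[_]; right|right].
Qed.

(** Add the points of [t] in an order such that the value stays in [S] until a
single added point is selected: drop selected points one at a time. *)
Lemma first_escape S (t : seq X) : closed S -> S !=set0 ->
  ~ S (F (S `|` [set` t])) ->
  exists (t' : seq X) (b : X),
    S (F (S `|` [set` t'])) /\ escape F (S `|` [set` t']) b.
Proof.
move=> cS [x0 Sx0].
have [n tn] := ubnP (size t); elim: n => // n IH in t tn * => nSF.
have ct (u : seq X) : closed (S `|` [set` u]) by exact: closed_setU_seq.
have bt : F (S `|` [set` t]) \in t.
  by have [|//] := Fsel.1 _ (ct t) (ex_intro _ x0 (or_introl Sx0)).
set b := F _ in bt; pose t' := [seq x <- t | x != b].
have tE := setU_seq_rem S bt; rewrite -/t' in tE.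
have nt'b : ~ (S `|` [set` t']) b.
  by case=> [Sb|]; [exact: nSF|rewrite /= mem_filter eqxx].
have [Ft'|nFt'] := pselect (S (F (S `|` [set` t']))).
  by exists t', b; split => //; apply: escapeP => //; rewrite -tE.
have t'lt : (size t' < size t)%N.
  rewrite size_filter -(count_predC (pred1 b) t).
  by rewrite -[X in (X < _)%N]add0n ltn_add2r -has_count has_pred1.
exact: IH t' (leq_trans t'lt tn) nFt'.
Qed.

(** A maximal closed extension exists because the values vary continuously
along the closures of unions of chains, and [E] is closed. *)
Lemma maximal_extension (E K S : set X) :
  closed E -> closed K -> closed S -> S !=set0 -> S `<=` K -> E (F S) ->
  exists M, [/\ closed M, S `<=` M, M `<=` K, E (F M) &
    forall x, K x -> ~ M x -> ~ E (F (M `|` [set x]))].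
Proof.
move=> cE cK cS nS SK EFS.
pose good M := [/\ closed M, S `<=` M, M `<=` K & E (F M)].
have gS : good S by split.
pose R (a b : {M | good M}) : bool := `[< sval a `<=` sval b >].
have [| | |[M [cM SM MK EM]] Mmax] := @ZL_preorder _ (exist _ S gS) R.
- by move=> a; apply/asboolP.
- by move=> a b c /asboolP ba /asboolP ac; apply/asboolP; exact: subset_trans ac.
- move=> A Atot; have [[a0 Aa0]|A0] := pselect (A !=set0); last first.
    by exists (exist _ S gS) => a Aa; case: A0; exists a.
  pose U := \bigcup_(a in A) sval a.
  have gU : good (closure U).
    have SU : S `<=` closure U.
      have [_ Sa0 _ _] := svalP a0.
      by move=> x /Sa0 ax; apply: subset_closure; exists a0.
    split=> //; first exact: closed_closure.
      rewrite [K](closure_id _).1 //; apply: closureS => x [a _ ax].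
      by have [_ _ aK _] := svalP a; exact: aK.
    apply: contrapT => nEF.
    have nU : closure U !=set0 by have [x Sx] := nS; exists x; exact: SU.
    have [s [sU sF]] := selection_near_dense Fsel (@closed_closure _ U) nU
      (@subset_closure _ U) (@subset_refl _ _) (closed_openC cE) nEF.
    have [a Aa sa] : exists2 a, A a & [set` s] `<=` sval a.
      elim: s sU {sF} => [_|x s IH sU]; first by exists a0.
      have [|a Aa sa] := IH; first by move=> y ys; apply: sU; rewrite /= inE ys orbT.
      have [b Ab bx] := sU x (mem_head _ _).
      have [/asboolP ab|/asboolP ba] := Atot _ _ Aa Ab.
        exists b => // y; rewrite /= inE => /orP[/eqP ->//|/sa]; exact: ab.
      exists a => // y; rewrite /= inE => /orP[/eqP ->|/sa//]; exact: ba.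
    have [ca _ _ Ea] := svalP a.
    apply: (sF (sval a)) => //.
    by move=> x ax; apply: subset_closure; exists a.
  exists (exist _ (closure U) gU) => a Aa; apply/asboolP => x /= ax.
  by apply: subset_closure; exists a.
exists M; split=> // x Kx nMx EMx; apply: nMx.
have gMx : good (M `|` [set x]).
  split=> //.
  - by apply: closedU => //; exact: hausdorff_closed1.
  - by move=> y /SM; left.
  - by move=> y [/MK|->].
have := Mmax (exist _ _ gMx).
by move=> /(_ (asboolT (@subsetUl _ _ _)))/asboolP; apply; right.
Qed.

End EscapeTheory.

(** * Selecting in the quasi-component of the value of the whole space *)

Definition quasi_component (X : topologicalType) (p : X) : set X :=
  [set x | forall K, clopen K -> K p -> K x].

(** Outside of the single point [e] the set [D] is clopen, and outside of [z]
the set [C] is.  Since [z] lies in [D], cutting one of the two sides of [C]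
down to the complement of [D] makes it clopen: take the side without [e]. *)
Lemma quasi_component_no_crossing (X : topologicalType) (p x e z : X)
    (C D : set X) :
  quasi_component p x ->
  open D -> closed (D `|` [set e]) -> D z -> ~ D x -> ~ D p ->
  open C -> closed (C `|` [set z]) -> ~ C z -> ~ (C x /\ ~ C p).
Proof.
move=> Qx oD cDe Dz nDx nDp oC cCz nCz [Cx nCp].
have [Ce|nCe] := pselect (C e).
  have LE : ~` C `&` ~` D = ~` (C `|` [set z]) `&` ~` (D `|` [set e]).
    apply/seteqP; split=> y [nCy nDy]; split=> //.
    - by move=> [//|yz]; apply: nDy; rewrite yz.
    - by move=> [//|ye]; apply: nCy; rewrite ye.
    - by move=> Cy; apply: nCy; left.
    - by move=> Dy; apply: nDy; left.
  have [] // := Qx (~` C `&` ~` D); split.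
    by rewrite LE; apply: openI; exact: closed_openC.
  by apply: closedI; exact: open_closedC.
have LE : C `&` ~` D = C `&` ~` (D `|` [set e]).
  apply/seteqP; split=> y [Cy nDy]; split=> //.
    by move=> [//|ye]; apply: nCe; rewrite -ye.
  by move=> Dy; apply: nDy; left.
have LE' : C `&` ~` D = (C `|` [set z]) `&` ~` D.
  apply/seteqP; split=> y [Cy nDy]; split=> //; first by left.
  by case: Cy => // yz; case: nDy; rewrite yz.
have cL : clopen (C `&` ~` D).
  split; first by rewrite LE; apply: openI => //; exact: closed_openC.
  by rewrite LE'; apply: closedI => //; exact: open_closedC.
by have [] // := Qx _ (clopenC set0 cL) => -[].
Qed.

Lemma quasi_component_no_separation (X : topologicalType) (p x e z : X)
    (C D : set X) :
  quasi_component p x ->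
  open D -> closed (D `|` [set e]) -> D z -> ~ D x -> ~ D p ->
  open C -> closed (C `|` [set z]) -> ~ C z -> (C x <-> C p).
Proof.
move=> Qx oD cDe Dz nDx nDp oC cCz nCz; split=> [Cx|Cp]; apply: contrapT => nC.
  exact: (quasi_component_no_crossing Qx oD cDe Dz nDx nDp oC cCz nCz).
apply: (@quasi_component_no_crossing X p x e z (~` (C `|` [set z])) D) => //.
- exact: closed_openC.
- have -> : ~` (C `|` [set z]) `|` [set z] = ~` C; last exact: open_closedC.
  apply/seteqP; split=> y.
    by case=> [nCz' Cy|->//]; apply: nCz'; left.
  by have [->|yz] := pselect (y = z); [right|left=> -[]].
- by case; right.
- split; last by apply; left.
  by move=> [//|xz]; apply: nDx; rewrite xz.
Qed.

Section QuasiComponent.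
Variables (X : topologicalType) (F : set X -> X) (p : X).
Hypotheses (hX : hausdorff_space X) (Fsel : set_selection F).
Hypothesis (FXp : F [set: X] = p).

Let closed1 (x : X) : closed [set x]. Proof. exact: hausdorff_closed1. Qed.

Lemma near_whole_space O : open O -> O p ->
  exists s : seq X, forall T, closed T -> [set` s] `<=` T -> O (F T).
Proof.
move=> oO; rewrite -FXp => OF.
have [s [_ sO]] := selection_near Fsel closedT (ex_intro _ p I) oO OF.
by exists s => T cT sT; exact: sO.
Qed.

Lemma closed_escape S : closed S -> closed (escape F S `|` [set F S]).
Proof.
move=> cS; rewrite /closed closureU -((closure_id [set _]).1 (@closed1 _)).
by move=> x [clx|->]; [exact: closure_escape|right].
Qed.

Lemma selection_pair x y : F ([set x] `|` [set y]) = x \/ F ([set x] `|` [set y]) = y.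
Proof.
have c2 : closed ([set x] `|` [set y]) by exact: closedU.
by have [] := Fsel.1 _ c2 (ex_intro _ x (or_introl erefl)); [left|right].
Qed.

Lemma selection1 x : F [set x] = x.
Proof. by have := Fsel.1 _ (@closed1 x) (ex_intro _ x erefl). Qed.

(** Any point [z] of the quasi-component [Q] of [p] cuts [X] into the points
that win and those that lose against [z] in two-point sets.  For [z] near [p]
the cut at [z] separates [p] from a point of [Q] fixed in advance: one that
lies on the same side of [p] as [z]. *)
Lemma quasi_component_cut_near :
  exists (s : seq X) (N : set X), [/\ open N, N p, p \notin s &
    forall z, N z -> z <> p -> quasi_component p z ->
      exists x, [/\ x \in s, quasi_component p x &
        ~ (escape F [set z] x <-> escape F [set z] p)]].
Proof.
have [s0 [N0 [oN0 N0p ps0 N0z]]] : exists (s : seq X) (N : set X),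
    [/\ open N, N p, p \notin s & forall z, N z -> z <> p ->
      quasi_component p z -> F ([set z] `|` [set p]) = z ->
      exists x, [/\ x \in s, quasi_component p x & escape F [set z] x]].
  have [[x0 [Qx0 x0p Fx0]]|nex] := pselect (exists x0,
      [/\ quasi_component p x0, x0 <> p & F ([set x0] `|` [set p]) = x0]).
    exists [:: x0], (~` [set y | F ([set x0] `|` [set y]) = y]); split.
    - apply: closed_openC; apply: closed_fixpoints => //.
      exact: selection_add_continuous.
    - by rewrite /= Fx0.
    - by rewrite inE; apply/eqP => px0; exact: x0p.
    - move=> z Nz zp Qz _; exists x0; split => //; first exact: mem_head.
      by rewrite /escape /= setUC.
  exists [::], setT; split=> //; first exact: openT.
  by move=> z _ zp Qz Fz; case: nex; exists z.
have [s1 [N1 [oN1 N1p ps1 N1z]]] : exists (s : seq X) (N : set X),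
    [/\ open N, N p, p \notin s & forall z, N z -> z <> p ->
      quasi_component p z -> F ([set z] `|` [set p]) = p ->
      exists x, [/\ x \in s, quasi_component p x & ~ escape F [set z] x]].
  have [[x1 [Qx1 x1p Fx1]]|nex] := pselect (exists x1,
      [/\ quasi_component p x1, x1 <> p & F ([set x1] `|` [set p]) = p]).
    exists [:: x1], (escape F [set x1]); split.
    - exact: open_escape.
    - by rewrite /escape /= Fx1 => px1; exact: x1p.
    - by rewrite inE; apply/eqP => px1; exact: x1p.
    - move=> z Nz zp Qz _; exists x1; split => //; first exact: mem_head.
      by rewrite /escape /= setUC escape_val //; apply.
  exists [::], setT; split=> //; first exact: openT.
  by move=> z _ zp Qz Fz; case: nex; exists z.
exists (s0 ++ s1), (N0 `&` N1); split => //.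
- exact: openI.
- by rewrite mem_cat negb_or ps0.
move=> z [N0z' N1z'] zp Qz.
have [Fz|Fz] := selection_pair z p.
  have [x [xs Qx ex]] := N0z z N0z' zp Qz Fz.
  exists x; split; rewrite ?mem_cat ?xs // => -[/(_ ex)].
  by rewrite /escape /= Fz.
have [x [xs Qx nex]] := N1z z N1z' zp Qz Fz.
exists x; split; rewrite ?mem_cat ?xs ?orbT // => -[_]; apply: contra_not nex.
by apply; rewrite /escape /= Fz => pz; exact: zp.
Qed.

(** A selected point [z] that was added last is separated from all the other
points of its set by the escape set it belongs to.  When the set contains the
points of the preceding lemma, such a [z] cannot be a point of the
quasi-component near [p] other than [p], while the values near [X] must be
near [p]. *)
Lemma quasi_component_stabilization (A : set X) :
  closed A -> ~ A p ->
  (forall C, closed C -> A `<=` C -> C p -> quasi_component p (F C)) ->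
  exists A', [/\ closed A', ~ A' p &
    forall C, closed C -> A' `<=` C -> C p -> F C = p].
Proof.
move=> cA nAp AQ.
have [s1 [N [oN Np ps1 Ncut]]] := quasi_component_cut_near.
pose A1 := A `|` [set` s1].
have cA1 : closed A1 by exact: closed_setU_seq.
have nA1p : ~ A1 p by case=> //; apply/negP.
have [s sN] := near_whole_space (openI oN (closed_openC cA1)) (conj Np nA1p).
pose s' := [seq x <- s | x != p].
exists (A1 `|` [set` s']); split.
- exact: closed_setU_seq.
- by case=> //; rewrite /= mem_filter eqxx.
move=> C cC A'C Cp; apply: contrapT => FCp.
have [u [uC uF]] := selection_near Fsel cC (ex_intro _ p Cp)
  (closed_openC (@closed1 p)) FCp.
pose B0 := A1 `|` [set p]; pose t := s ++ u.
have cB0 : closed B0 by apply: closedU.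
have cT : closed (B0 `|` [set` t]) by exact: closed_setU_seq.
have TC : B0 `|` [set` t] `<=` C.
  move=> x [[A1x|->//]|]; first by apply: A'C; left.
  rewrite /= mem_cat => /orP[xs|/uC//].
  have [->//|xp] := eqVneq x p.
  by apply: A'C; right; rewrite /= mem_filter xp.
pose z := F (B0 `|` [set` t]).
have zp : z <> p.
  by apply: uF => // x xu; right; rewrite /= mem_cat; apply/orP; right.
have [Nz nA1z] : (N `&` ~` A1) z.
  by apply: sN => // x xs; right; rewrite /= mem_cat; apply/orP; left.
have Qz : quasi_component p z.
  by apply: AQ => // [x Ax|]; left; [left; left|right].
have zt : z \in t.
  have [[//|//]|//] := Fsel.1 _ cT (ex_intro _ p (or_introl (or_intror erefl))).
pose B := B0 `|` [set` [seq x <- t | x != z]].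
have cB : closed B by exact: closed_setU_seq.
have Bp : B p by left; right.
have nBz : ~ B z by case=> [[//|//]|]; rewrite /= mem_filter eqxx.
have Dz : escape F B z.
  by apply: escapeP => //; rewrite /B -setU_seq_rem.
have [x [xs Qx nsep]] := Ncut z Nz zp Qz.
apply: nsep; apply: (@quasi_component_no_separation X p x (F B) z _ (escape F B)).
- exact: Qx.
- exact: open_escape.
- exact: closed_escape.
- exact: Dz.
- by move=> /(escape_notin hX Fsel cB); apply; left; left; right.
- by move=> /(escape_notin hX Fsel cB); apply.
- exact: open_escape.
- by have := closed_escape (@closed1 z); rewrite selection1.
- by move=> /(escape_notin hX Fsel (@closed1 z)); apply.
Qed.

End QuasiComponent.

(** * A cut point that is eventually selected *)

(** The value [p] of the whole space may or may not be the value of all large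
closed sets through [p]; the two cases call for different constructions. *)
Definition eventually_selected (X : topologicalType) (F : set X -> X) (p : X)
    (A : set X) : Prop :=
  [/\ closed A, ~ A p & forall C, closed C -> A `<=` C -> C p -> F C = p].

Definition cut_sides (X : topologicalType) (p : X) (U V : set X) : Prop :=
  [/\ open U, open V, U `&` V = set0, ~` [set p] = U `|` V &
    closure U p /\ closure V p].

Lemma cut_point_sides (X : topologicalType) (p : X) :
  cut_point p -> exists U V : set X, cut_sides p U V.
Proof.
move=> [U [V [UV clUV]]].
have [clUp clVp] : closure U p /\ closure V p.
  by have : (closure U `&` closure V) p by rewrite clUV.
have side (A B : set X) : ~` [set p] = A `|` B ->
    closure A `&` closure B = [set p] -> closure B p -> A = ~` closure B.
  move=> AB clAB clBp; apply/seteqP; split=> [x Ax clBx|x nBx].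
    have xp : x = p.
      by have : (closure A `&` closure B) x; [split=> //; exact: subset_closure|
        rewrite clAB].
    by have : (~` [set p]) x; [rewrite AB; left|exact].
  have : (~` [set p]) x by move=> xp; apply: nBx; rewrite xp.
  by rewrite AB => -[//|Bx]; case: nBx; exact: subset_closure.
have UE := side _ _ UV clUV clVp.
have VE : V = ~` closure U.
  by apply: side => //; [rewrite UV setUC|rewrite setIC].
exists U, V; split => //.
- by rewrite UE; apply: closed_openC; exact: closed_closure.
- by rewrite VE; apply: closed_openC; exact: closed_closure.
- apply/disjoints_subset; rewrite VE setCK; exact: subset_closure.
Qed.

Lemma cut_sides_sym (X : topologicalType) (p : X) (U V : set X) :
  cut_sides p U V -> cut_sides p V U.
Proof. by move=> [oU oV UV0 UV [clU clV]]; split=> //; [rewrite setIC|rewrite setUC]. Qed.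

Section EventuallySelected.
Variables (X : topologicalType) (F : set X -> X) (p : X) (A0 : set X).
Hypotheses (hX : hausdorff_space X) (Fsel : set_selection F).
Hypothesis A0p : eventually_selected F p A0.

Lemma eventually_selected_escape A : closed A -> A0 `<=` A -> ~ A p ->
  escape F A p.
Proof.
move=> cA A0A nAp; apply: escapeP => //.
have [_ _] := A0p; apply.
- by apply: closedU => //; exact: hausdorff_closed1.
- by move=> x /A0A; left.
- by right.
Qed.

(** Choose [u] in [U] so close to [p] that it is selected when added to [A],
and enlarge [A] by points of [V] as long as the value stays in [U].  As the
points of [U] do not change, the value keeps away from [p], so a maximal
enlargement exists; it misses [p], and is clopen because [U] and [V] are clopen
outside of [p]. *)
Lemma clopen_absorbing_side (U V A : set X) :
  cut_sides p U V -> closed A -> A0 `<=` A -> ~ A p ->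
  exists T, [/\ clopen T, A `&` V `<=` T & T `<=` V].
Proof.
move=> [oU oV UV0 UV [clUp _]] cA A0A nAp.
have [_ _ A0sel] := A0p.
have nUp : ~ U p by move=> Up; have : (~` [set p]) p; [rewrite UV; left|apply].
have nVp : ~ V p by move=> Vp; have : (~` [set p]) p; [rewrite UV; right|apply].
have cVp : closed (V `|` [set p]).
  have -> : V `|` [set p] = ~` U; last exact: open_closedC.
  apply/seteqP; split=> x.
    case=> [Vx Ux|->//].
    by have : set0 x by rewrite -UV0.
  move=> nUx; have [->|xp] := pselect (x = p); first by right.
  by left; have : (~` [set p]) x by []; rewrite UV => -[].
have cUp : closed (U `|` [set p]).
  have -> : U `|` [set p] = ~` V; last exact: open_closedC.
  apply/seteqP; split=> x.
    case=> [Ux Vx|->//].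
    by have : set0 x by rewrite -UV0.
  move=> nVx; have [->|xp] := pselect (x = p); first by right.
  by left; have : (~` [set p]) x by []; rewrite UV => -[].
have [u [Uu eu]] := clUp _ (open_nbhs_nbhs (conj (open_escape hX Fsel cA)
  (eventually_selected_escape cA A0A nAp))).
have Fu := escape_val hX Fsel cA eu.
(* the points of [U] that enlargements of [A `|` [set u]] may contain *)
pose E := (A `&` (U `|` [set p])) `|` [set u].
have cu : closed [set u] by exact: hausdorff_closed1.
have cE : closed E by apply: closedU => //; exact: closedI.
have EU : E `<=` U by move=> x [[Ax [//|xp]]|->//]; case: nAp; rewrite -xp.
pose K := E `|` (V `|` [set p]).
have cK : closed K by exact: closedU.
have AuK : A `|` [set u] `<=` K.
  move=> x [Ax|->]; last by left; right.
  have : (~` [set p]) x by move=> xp; apply: nAp; rewrite -xp.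
  by rewrite UV => -[Ux|Vx]; [left; left; split=> //; left|right; left].
have cAu : closed (A `|` [set u]) by exact: closedU.
have EFAu : E (F (A `|` [set u])) by rewrite Fu; right.
have [M [cM AM MK EFM Mmax]] := maximal_extension hX Fsel cE cK cAu
  (ex_intro _ u (or_intror erefl)) AuK EFAu.
have nMp : ~ M p.
  move=> Mp; apply: nUp; have := EU _ EFM.
  by rewrite A0sel // => x /A0A Ax; apply: AM; left.
exists (M `&` V); split; last exact: subIsetr; last first.
  by move=> x [Ax Vx]; split=> //; apply: AM; left.
split; last first.
  have -> : M `&` V = M `&` (V `|` [set p]); last exact: closedI.
  apply/seteqP; split=> x [Mx Vx]; split=> //; first by left.
  by case: Vx => // xp; case: nMp; rewrite -xp.
rewrite openE => v [Mv Vv].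
have Uv : nbhs v [set y | U (F (M `|` [set y]))].
  apply: (selection_add_continuous hX Fsel cM); apply: open_nbhs_nbhs; split=> //.
  have -> : M `|` [set v] = M by apply/setUidPl => _ ->.
  exact: EU.
have nV : nbhs v V by exact: open_nbhs_nbhs.
apply: filterS (filterI Uv nV) => y [/= Uy Vy]; split => //.
apply: contrapT => nMy; apply: (Mmax y) => //; first by right; left.
have cMy : closed (M `|` [set y]) by apply: closedU => //; exact: hausdorff_closed1.
have [My|Fy] := Fsel.1 _ cMy (ex_intro _ y (or_intror erefl)).
  have [//|[Vz|zp]] := MK _ My.
    by have : set0 (F (M `|` [set y])) by rewrite -UV0.
  by case: nMp; rewrite -zp.
have FyE : F (M `|` [set y]) = y by [].
by rewrite FyE in Uy; have : set0 y by rewrite -UV0.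
Qed.

Lemma clopen_absorbing (U V A : set X) :
  cut_sides p U V -> closed A -> A0 `<=` A -> ~ A p ->
  exists H, [/\ clopen H, A `<=` H & ~ H p].
Proof.
move=> UVp cA A0A nAp; have [_ _ _ UV _] := UVp.
have [T [cT AT TV]] := clopen_absorbing_side UVp cA A0A nAp.
have [S [cS AS SU]] := clopen_absorbing_side (cut_sides_sym UVp) cA A0A nAp.
exists (T `|` S); split; first exact: clopenU.
  move=> x Ax; have : (~` [set p]) x by move=> xp; apply: nAp; rewrite -xp.
  by rewrite UV => -[Ux|Vx]; [right; exact: AS|left; exact: AT].
move=> TSp; have : (~` [set p]) p; last exact.
by rewrite UV; case: TSp => [/TV|/SU]; [right|left].
Qed.

Lemma clopen_escape H : clopen H -> H !=set0 -> clopen (escape F H).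
Proof.
move=> [oH cH] nH; split; first exact: open_escape.
move=> y cly; have [//|yF] := closure_escape hX Fsel cH cly.
have Hy : H y by rewrite yF; exact: Fsel.1.
have [z [ez Hz]] := cly H (open_nbhs_nbhs (conj oH Hy)).
by have := escape_notin hX Fsel cH ez.
Qed.

(** Let [H n] be clopen sets increasing in such a way that [H n.+1] contains a
point which is selected when added to [H n], taken alternately from the two
sides of [p].  The value of the closure of their union is a limit of such
points from either side, so it is [p]. *)
Lemma eventually_selected_null_sequence (U V : set X) :
  cut_sides p U V -> exists W, clopen_null_sequence p W.
Proof.
move=> UVp; have [oU oV UV0 UV [clUp clVp]] := UVp.
have [cA0 nA0p _] := A0p.
pose good H := [/\ clopen H, A0 `<=` H, ~ H p & H !=set0].
pose side n := if odd n then V else U.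
have clside n : closure (side n) p by rewrite /side; case: ifP.
have /choice[next nextP] (nH : nat * set X) : exists xH : X * set X,
    good nH.2 -> [/\ escape F nH.2 xH.1, side nH.1 xH.1, good xH.2,
      nH.2 `<=` xH.2 & xH.2 xH.1].
  case: nH => n H /=; have [[cH A0H nHp nH]|] := pselect (good H); last first.
    by exists (p, H).
  have [x [sx ex]] := clside n _ (open_nbhs_nbhs (conj (open_escape hX Fsel cH.2)
    (eventually_selected_escape cH.2 A0H nHp))).
  have xp : x <> p.
    move=> xp; have : (~` [set p]) x; last by rewrite xp; apply.
    by rewrite UV; move: sx; rewrite /side; case: ifP; [right|left].
  have [|||H' [cH' HH' nH'p]] := @clopen_absorbing U V (H `|` [set x]) UVp.
  - by apply: closedU; [exact: cH.2|exact: hausdorff_closed1].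
  - by move=> y /A0H; left.
  - by case=> // px; exact: xp.
  exists (x, H') => _; split=> //=.
  - split=> //; first by move=> y /A0H Hy; apply: HH'; left.
    by exists x; apply: HH'; right.
  - by move=> y Hy; apply: HH'; left.
  - by apply: HH'; right.
have [u [Uu eu]] := clUp _ filterT.
have up : u <> p.
  by move=> up; have : (~` [set p]) u; [rewrite UV; left|rewrite up; apply].
have [|||H0 [cH0 A0H0 nH0p]] := @clopen_absorbing U V (A0 `|` [set u]) UVp.
- by apply: closedU => //; exact: hausdorff_closed1.
- by move=> y; left.
- by case=> // px; exact: up.
have gH0 : good H0.
  split=> //; first by move=> y A0y; apply: A0H0; left.
  by exists u; apply: A0H0; right.
pose H := fix H n := if n is m.+1 then (next (m, H m)).2 else H0.
have gH n : good (H n).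
  by elim: n => // n IH; have [] := nextP (n, H n) IH.
pose x n := (next (n, H n)).1.
have xP n : [/\ escape F (H n) (x n), side n (x n), H n `<=` H n.+1 &
    H n.+1 (x n)] by have [] := nextP (n, H n) (gH n).
have Hmono m n : (m <= n)%N -> H m `<=` H n.
  elim: n => [|n IH]; first by rewrite leqn0 => /eqP ->.
  rewrite leq_eqVlt => /orP[/eqP ->//|/IH mn] y /mn.
  by have [_ _ HH _] := xP n; exact: HH.
pose Y := closure (\bigcup_n H n).
have HY n : H n `<=` Y.
  by move=> y Hy; apply: subset_closure; exists n.
have nY : Y !=set0 by exists u; apply: (HY 0%N); apply: A0H0; right.
have cHn n : closed (H n) by have [[]] := gH n.
have near_Y O : open O -> O (F Y) -> exists k, forall n, (k <= n)%N ->
    forall y, escape F (H n) y -> Y y -> O y.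
  move=> oO OFY.
  have [s [sH sO]] := selection_near_dense Fsel (@closed_closure _ _) nY
    (@subset_closure _ _) (@subset_refl _ _) oO OFY.
  have [k kH] := monotone_seq_cover Hmono sH.
  exists k => n kn y ey Yy; rewrite -(escape_val hX Fsel (cHn n) ey); apply: sO.
  - by apply: closedU => //; exact: hausdorff_closed1.
  - by move=> z /(kH n kn); left.
  - by move=> z [/HY//|->].
have FYp : F Y = p.
  apply: contrapT => FYp.
  have far n O : open O -> O (F Y) -> (forall m, side (n + m.*2) `&` O = set0) ->
      False.
    move=> oO OFY dO; have [k kO] := near_Y O oO OFY.
    have [ex sx _ Hx] := xP (n + k.*2)%N.
    have Ox : O (x (n + k.*2)%N).
      apply: (kO (n + k.*2)%N) => //; last exact: HY Hx.
      by rewrite -addnn addnCA leq_addr.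
    by have : set0 (x (n + k.*2)%N) by rewrite -(dO k).
  have : (~` [set p]) (F Y) by [].
  rewrite UV => -[UF|VF].
    by apply: (far 1%N U) => // m; rewrite /side add1n /= odd_double setIC.
  by apply: (far 0%N V) => // m; rewrite /side add0n odd_double.
exists (fun n => escape F (H n) `&` H n.+1); split=> [n|O oO Op].
  have [[oHn _] _ nHp nHn] := gH n; have [cHS _ nHSp _] := gH n.+1.
  split; last by case.
  - by apply: clopenI => //; apply: clopen_escape => //; split.
  - by exists (x n); have [] := xP n.
have [|k kO] := near_Y O oO; first by rewrite FYp.
by exists k => n kn y [ey /HY Yy]; exact: kO ey Yy.
Qed.

End EventuallySelected.

(** * A value that is not eventually selected *)

Section NotEventuallySelected.
Variables (X : topologicalType) (F : set X -> X) (p : X).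
Hypotheses (hX : hausdorff_space X) (Fsel : set_selection F).
Hypothesis (FXp : F [set: X] = p).
Hypothesis never : forall A, ~ eventually_selected F p A.

Lemma clopen_cover_outside (G : set X) (w : seq X) : clopen G -> ~ G p ->
  exists G', [/\ clopen G', ~ G' p, G `<=` G' &
    forall x, x \in w -> G' x \/ quasi_component p x].
Proof.
move=> cG nGp; elim: w => [|x w [G' [cG' nG'p GG' G'w]]]; first by exists G; split.
have [Qx|nQx] := pselect (quasi_component p x).
  exists G'; split=> // y; rewrite inE => /orP[/eqP ->|/G'w//]; by right.
have [K [cK Kp nKx]] : exists K, [/\ clopen K, K p & ~ K x].
  apply: contrapT => nK; apply: nQx => K cK Kp.
  by apply: contrapT => nKx; apply: nK; exists K.
exists (G' `|` ~` K); split.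
- by apply: clopenU => //; exact: clopenC set0 cK.
- by case=> //; apply.
- by move=> y /GG'; left.
by move=> y; rewrite inE => /orP[/eqP ->|/G'w[G'y|Qy]];
  [left; right|left; left|right].
Qed.

(** A closed set through [p] whose value leaves the quasi-component of [p] gives
a clopen set [E] around that value, and a maximal closed set [~` D] with value
in [E] is clopen. *)
Lemma clopen_value_step (G : set X) (w : seq X) : clopen G -> ~ G p ->
  exists (E D : set X) (s : seq X),
    [/\ clopen E /\ clopen D, ~ E p /\ ~ D p,
        (E `|` D) `&` (G `|` [set` w]) = set0, [set` s] `<=` ~` D &
        forall T, closed T -> [set` s] `<=` T -> T `<=` ~` D -> E (F T)].
Proof.
move=> cG nGp.
have [G' [cG' nG'p GG' G'w]] := clopen_cover_outside w cG nGp.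
have [s0 s0F] := near_whole_space Fsel FXp (closed_openC cG'.2) nG'p.
pose A := G' `|` [set` [seq x <- s0 ++ w | x != p]].
have cA : closed A by apply: closed_setU_seq => //; exact: cG'.2.
have nAp : ~ A p by case=> //; rewrite /= mem_filter eqxx.
have [C [cC AC Cp nQ]] : exists C,
    [/\ closed C, A `<=` C, C p & ~ quasi_component p (F C)].
  apply: contrapT => nC.
  have [|A' [cA' nA'p A'F]] := quasi_component_stabilization hX Fsel FXp cA nAp.
    by move=> C cC AC Cp; apply: contrapT => nQ; apply: nC; exists C.
  by apply: (never (A := A')).
have inC x : x \in s0 ++ w -> C x.
  move=> xs; have [->//|xp] := eqVneq x p.
  by apply: AC; right; rewrite /= mem_filter xp.
have [K [cK Kp nKF]] : exists K, [/\ clopen K, K p & ~ K (F C)].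
  apply: contrapT => nK; apply: nQ => K cK Kp.
  by apply: contrapT => nKF; apply: nK; exists K.
pose E := ~` (G' `|` K).
have cE : clopen E by apply: clopenC set0 _; exact: clopenU.
have EFC : E (F C).
  case=> // G'F; apply: (s0F C) => // x xs.
  by apply: inC; rewrite mem_cat; apply/orP; left.
have [M [cM CM _ EFM Mmax]] := maximal_extension hX Fsel cE.2 closedT cC
  (ex_intro _ p Cp) (@subsetT _ C) EFC.
have Mp : M p by exact: CM.
have oM : open M.
  rewrite openE => v Mv.
  have Ev : nbhs v [set y | E (F (M `|` [set y]))].
    apply: (selection_add_continuous hX Fsel cM); apply: open_nbhs_nbhs.
    have -> : M `|` [set v] = M by apply/setUidPl => _ ->.
    by split=> //; exact: cE.1.
  by apply: filterS Ev => y Ey; apply: contrapT => nMy; exact: Mmax Ey.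
have [s [sM sE]] := selection_near Fsel cM (ex_intro _ p Mp) cE.1 EFM.
have cD : clopen (~` M) by apply: clopenC set0 _.
exists E, (~` M), s; rewrite setCK; split => //.
- by split=> [|/(_ Mp)//]; apply; right.
- rewrite setIUl; apply/seteqP; split=> // x [[nEx [Gx|xw]]|[nMx [Gx|xw]]].
  + by apply: nEx; left; exact: GG'.
  + have [G'x|Qx] := G'w x xw; apply: nEx; [by left|right; exact: Qx].
  + by apply: nMx; apply/CM/AC; left; exact: GG'.
  + by apply: nMx; apply/CM/inC; rewrite mem_cat; apply/orP; right.
Qed.

(** Iterating the step yields disjoint clopen sets [E n `|` D n].  Removing all
those of index at least [k] leaves closed sets that increase to [X], so every
value on a set between them and [X] is close to [p] for large [k]; and removing
only the [D n] gives such a set with value in [E k], so some removed point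
escapes. *)
Lemma not_eventually_selected_null_sequence :
  exists W, clopen_null_sequence p W.
Proof.
have /choice[next nextP] (Gw : set X * seq X) : exists EDs : set X * set X * seq X,
    clopen Gw.1 -> ~ Gw.1 p ->
    [/\ clopen EDs.1.1 /\ clopen EDs.1.2, ~ EDs.1.1 p /\ ~ EDs.1.2 p,
        (EDs.1.1 `|` EDs.1.2) `&` (Gw.1 `|` [set` Gw.2]) = set0,
        [set` EDs.2] `<=` ~` EDs.1.2 &
        forall T, closed T -> [set` EDs.2] `<=` T -> T `<=` ~` EDs.1.2 ->
          EDs.1.1 (F T)].
  have [[cG nGp]|nG] := pselect (clopen Gw.1 /\ ~ Gw.1 p); last first.
    by exists (set0, set0, [::]) => cG nGp; case: nG.
  have [E [D [s EDs]]] := clopen_value_step Gw.2 cG nGp.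
  by exists (E, D, s).
pose st := fix st n : set X * seq X := if n is m.+1 then
  ((st m).1 `|` ((next (st m)).1.1 `|` (next (st m)).1.2),
   (st m).2 ++ (next (st m)).2) else (set0, [::]).
pose G n := (st n).1; pose w n := (st n).2.
pose E n := (next (st n)).1.1; pose D n := (next (st n)).1.2.
pose s n := (next (st n)).2.
have Ggood n : clopen (G n) /\ ~ G n p.
  elim: n => [|n [cG nGp]]; first by split=> //; exact: clopen0.
  have [[cE cD] [nEp nDp] _ _ _] := nextP (st n) cG nGp.
  by split; [apply: clopenU => //; exact: clopenU|case=> // -[]].
have stP n : [/\ clopen (E n) /\ clopen (D n), ~ E n p /\ ~ D n p,
    (E n `|` D n) `&` (G n `|` [set` w n]) = set0, [set` s n] `<=` ~` D n &
    forall T, closed T -> [set` s n] `<=` T -> T `<=` ~` D n -> E n (F T)].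
  by have [cG nGp] := Ggood n; exact: nextP.
have Gmono m n : (m < n)%N -> E m `|` D m `<=` G n.
  elim: n => // n IH; rewrite ltnS leq_eqVlt => /orP[/eqP <-|/IH mn].
    by move=> x EDx; right.
  by move=> x /mn; left.
have wmono m n : (m < n)%N -> [set` s m] `<=` [set` w n].
  elim: n => // n IH; rewrite ltnS leq_eqVlt => /orP[/eqP <-|/IH mn] x xs.
    by rewrite /w /= mem_cat; apply/orP; right.
  by rewrite /w /= mem_cat; apply/orP; left; exact: mn.
pose P n := E n `|` D n.
have cP n : clopen (P n) by have [[cE cD] _ _ _ _] := stP n; exact: clopenU.
have nPp n : ~ P n p by have [_ [nE nD] _ _ _] := stP n; case.
have Pdisj m n x : (m < n)%N -> P m x -> ~ P n x.
  move=> mn Pmx Pnx; have [_ _ dis _ _] := stP n.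
  have : set0 x by rewrite -dis; split=> //; left; exact: Gmono mn _ Pmx.
  by [].
pose R k := ~` \bigcup_(n in [set n | (k <= n)%N]) P n.
have cR k : closed (R k).
  by apply: open_closedC; apply: bigcup_open => n _; exact: (cP n).1.
have Rp k : R k p by move=> [n _ /nPp].
have escapeR k : exists (t : seq X) (b : X),
    [/\ R k (F (R k `|` [set` t])), escape F (R k `|` [set` t]) b & ~ R k b].
  pose S := ~` \bigcup_(n in [set n | (k <= n)%N]) D n.
  have cS : closed S.
    apply: open_closedC; apply: bigcup_open => n _.
    by have [[_ [oD _]] _ _ _ _] := stP n.
  have RS : R k `<=` S by move=> x nP [n kn Dx]; apply: nP; exists n => //; right.
  have [[[oE _] _] _ _ sD sE] := stP k.
  have SD : S `<=` ~` D k by move=> x nS Dx; apply: nS; exists k => //=.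
  have sS : [set` s k] `<=` S.
    move=> x xs [n /= kn Dx]; move: kn; rewrite leq_eqVlt => /orP[/eqP kn|kn].
      by apply: (sD x) => //; rewrite kn.
    have [_ _ dis _ _] := stP n.
    have : set0 x by rewrite -dis; split; [right|right; exact: wmono kn _ xs].
    by [].
  have [t [tS tF]] := selection_near Fsel cS (ex_intro _ p (RS _ (Rp k))) oE
    (sE S cS sS SD).
  have [|t' [b [Ft' et']]] :=
      @first_escape _ _ hX Fsel (R k) t (cR k) (ex_intro _ p (Rp k)).
    move=> RF; have : E k (F (R k `|` [set` t])).
      apply: tF; [exact: closed_setU_seq|by move=> x xt; right|].
      by move=> x [/RS//|/tS].
    by move=> EF; apply: RF; exists k => //=; left.
  exists t', b; split=> // Rb.
  by apply: (escape_notin hX Fsel _ et'); [exact: closed_setU_seq|left].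
have /choice[W WP] k : exists W, [/\ clopen W, W !=set0, ~ W p &
    forall y, W y -> exists T, [/\ closed T, R k `<=` T & F T = y]].
  have [t [b [Ft et /contrapT[n kn Pb]]]] := escapeR k.
  have cRt : closed (R k `|` [set` t]) by exact: closed_setU_seq.
  exists (P n `&` escape F (R k `|` [set` t])); split.
  - split; first by apply: openI; [exact: (cP n).1|exact: open_escape].
    move=> y cly; have [clP cle] := closureI cly.
    have Py : P n y by exact: (cP n).2.
    split=> //; have [//|yF] := closure_escape hX Fsel cRt cle.
    by case: Ft; exists n => //; rewrite -yF.
  - by exists b.
  - by case=> /nPp.
  move=> y [_ ey]; exists (R k `|` [set` t] `|` [set y]); split.
  - by apply: closedU => //; exact: hausdorff_closed1.
  - by move=> x Rx; left; left.
  - exact: escape_val.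
exists W; split=> [n|O oO Op]; first by have [] := WP n.
have [u uO] := near_whole_space Fsel FXp oO Op.
have Rmono m n : (m <= n)%N -> R m `<=` R n.
  move=> mn x nx [j /= nj Px]; apply: nx; exists j => //=; exact: leq_trans nj.
have [|k kR] := monotone_seq_cover (s := u) Rmono.
  move=> x _; have [[n Px]|nP] := pselect (exists n, P n x); last first.
    by exists 0%N => // -[n _ Px]; apply: nP; exists n.
  by exists n.+1 => // -[m /= nm Pmx]; exact: Pdisj nm Px Pmx.
exists k => n kn y Wy; have [_ _ _ Wval] := WP n.
have [T [cT RT <-]] := Wval y Wy.
by apply: uO => // x /(kR n kn); exact: RT.
Qed.

End NotEventuallySelected.

(** * The characterization *)

Lemma cut_point_null_sequence (X : topologicalType) (F : set X -> X) (p : X) :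
  hausdorff_space X -> set_selection F -> F [set: X] = p -> cut_point p ->
  exists W, clopen_null_sequence p W.
Proof.
move=> hX Fsel FXp /cut_point_sides[U [V UVp]].
have [[A Ap]|never] := pselect (exists A, eventually_selected F p A).
  exact: eventually_selected_null_sequence Ap _ _ UVp.
apply: not_eventually_selected_null_sequence hX Fsel FXp _ => A Ap.
by apply: never; exists A.
Qed.

Lemma isolated_open1 (X : topologicalType) (p : X) :
  isolated [set: X] p -> open [set p].
Proof.
move=> [_ [V nV]]; rewrite setIT => VE; rewrite openE => _ ->.
by rewrite /interior -VE.
Qed.

Theorem theorem1p1 (X : topologicalType)
    (Xinf : infinite_set [set: X])
    (Xhaus : hausdorff_space X)
    (Xsel : exists f : hyperspace X -> X, continuous_selection f) :
  approachable_points X =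
  [set p | selection_points X p /\ (isolated setT p \/ cut_point p)].
Proof.
have [F Fsel] : exists F : set X -> X, set_selection F.
  have [x0 _] := infinite_setN0 Xinf.
  have [f fsel] := Xsel.
  pose T := Hyperspace (@closedT X) (ex_intro setT x0 I).
  have /selection_pointsP[F Fsel _] : selection_points X (f T).
    by exists f => //; exists T.
  by exists F.
apply/seteqP; split=> p /=.
- case=> [ip|[U [oU Up clU qU]]].
  + split; last by left.
    apply/selection_pointsP; apply: isolated_selection_value Fsel.
      exact: isolated_open1.
    exact: hausdorff_closed1.
  + have [W Wp] := approachable_null_sequence Xhaus oU Up clU qU.
    split; last by right; exact: null_sequence_cut_point Wp.
    by apply/selection_pointsP; exact: null_sequence_selection_value Wp Fsel.
- move=> [/selection_pointsP[F' F'sel F'p] [ip|cp]]; first by left.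
  have [W Wp] := cut_point_null_sequence Xhaus F'sel F'p cp.
  exact: null_sequence_approachable Wp.
Qed.
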